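(* Let $E$ be a complex Banach space and let $T \in \mathcal{B}(E)$ be a nonzero quasinilpotent operator. If the Deddens algebra $\mathcal{D}_T$ associated with $T$ is closed (in the operator norm topology) and localizing, then $T$ has a nontrivial closed hyperinvariant subspace, that is, there is a closed subspace $F \subseteq E$ with $F \neq \{0\}$ and $F \neq E$ such that $RF \subseteq F$ for every $R \in \mathcal{B}(E)$ with $RT = TR$.
   Context: $\mathcal{B}(E)$ denotes the algebra of all bounded linear operators on the complex Banach space $E$. An operator $T \in \mathcal{B}(E)$ is quasinilpotent if $\sigma(T)=\{0\}$, equivalently $\lim_{n\to\infty}\|T^n\|^{1/n}=0$. The Deddens algebra $\mathcal{D}_T$ associated with $T \in \mathcal{B}(E)$ is the set of all $X \in \mathcal{B}(E)$ for which there is a constant $M>0$ (depending on $X$) such that $\|T^n X f\| \leq M \|T^n f\|$ for every $n \in \mathbb{N}$ and every $f \in E$. It is a unital subalgebra of $\mathcal{B}(E)$ containing the commutant of $T$. A linear subspace $\mathcal{X} \subseteq \mathcal{B}(E)$ is localizing if there is a closed ball $B \subseteq E$ (of positive radius) such that $0 \notin B$ and such that for every sequence $(f_n)$ of vectors in $B$ there are a subsequence $(f_{n_j})$ and a sequence $(X_j)$ of operators in $\mathcal{X}$ with $\|X_j\| \leq 1$ for all $j$ such that $(X_j f_{n_j})$ converges in norm to some nonzero vector of $E$. *)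

(* Defs.v *)
From HB Require Import structures.
From mathcomp Require Import all_boot all_order all_algebra.
From mathcomp Require Import complex.
From mathcomp Require Import all_classical all_reals all_analysis.

Set Implicit Arguments.
Unset Strict Implicit.
Unset Printing Implicit Defensive.

Import Order.TTheory GRing.Theory Num.Theory.
Import numFieldNormedType.Exports.

Local Open Scope classical_set_scope.
Local Open Scope ring_scope.

(* A complex Banach space is a [completeNormedModType R[i]] with [R : realType].
   Its norm takes values in [R[i]], whose order satisfies [x <= y] iff
   [Im x = Im y] and [Re x <= Re y]; thus [0 <= x] forces [x] to be real. *)

Section BoundedOperators.
Context {R : realType} (E : normedModType R[i]).

(* For linear maps between normed spaces, bounded is the same as continuous
   ([linear_bounded_continuous]). *)
Definition bounded_op : {pred E -> E} :=
  fun f => `[< linear f /\ continuous f >].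

Record bop := BOp { bop_fun : E -> E; bop_funP : bop_fun \in bounded_op }.

End BoundedOperators.

Coercion bop_fun : bop >-> Funclass.
Arguments bounded_op {R} E.
Arguments bop_fun {R E}.
Notation "''B' ( E )" := (bop E) (at level 8, format "''B' ( E )") : type_scope.

Section BoundedOperatorsSpace.
Context {R : realType} {E : normedModType R[i]}.

HB.instance Definition _ := [isSub for @bop_fun R E].
HB.instance Definition _ := [Choice of bop E by <:].

Lemma bounded_opP (f : E -> E) :
  f \in bounded_op E <-> linear f /\ continuous f.
Proof. by rewrite unfold_in; split => [/asboolP|?]; last exact/asboolP. Qed.

Lemma bounded_op_submod : submod_closed (bounded_op E).
Proof.
split; first by apply/bounded_opP; split;
  [move=> a x y; rewrite scaler0 addr0|exact: cst_continuous].
move=> a f g /bounded_opP[lf cf] /bounded_opP[lg cg]; apply/bounded_opP; split.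
  move=> b x y; rewrite !fctE lf lg !scalerDr !scalerA (mulrC a b).
  by rewrite addrACA.
by move=> x; apply: cvgD; [apply: cvgZr; exact: cf|exact: cg].
Qed.

HB.instance Definition _ :=
  GRing.isSubmodClosed.Build R[i] (E -> E) (bounded_op E) bounded_op_submod.
HB.instance Definition _ := [SubChoice_isSubLmodule of bop E by <:].

Lemma bopP (X Y : bop E) : X =1 Y -> X = Y.
Proof. by move=> XY; apply: val_inj; apply/funext. Qed.

Lemma bop_linear (X : bop E) : linear X.
Proof. by have /bounded_opP[] := bop_funP X. Qed.

HB.instance Definition _ (X : bop E) :=
  GRing.isLinear.Build R[i] E E _ (bop_fun X) (bop_linear X).

Lemma bop_continuous (X : bop E) : continuous X.
Proof. by have /bounded_opP[] := bop_funP X. Qed.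

Lemma bopDE (X Y : bop E) f : (X + Y) f = X f + Y f. Proof. by []. Qed.
Lemma bopNE (X : bop E) f : (- X) f = - X f. Proof. by []. Qed.
Lemma bopZE a (X : bop E) f : (a *: X) f = a *: X f. Proof. by []. Qed.
Lemma bop0E f : (0 : bop E) f = 0. Proof. by []. Qed.

Lemma bop_one_subproof : (@id E) \in bounded_op E.
Proof. by apply/bounded_opP; split => // x; exact: cvg_id. Qed.

Lemma bop_mul_subproof (X Y : bop E) : (X \o Y) \in bounded_op E.
Proof.
apply/bounded_opP; split; first by move=> a x y /=; rewrite !linearP.
by move=> x; apply: continuous_comp; exact: bop_continuous.
Qed.

Definition bop_one : bop E := BOp bop_one_subproof.
Definition bop_mul (X Y : bop E) : bop E := BOp (bop_mul_subproof X Y).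

(* [E] may be the zero space, so [1 != 0] is not guaranteed. *)
Fact bop_mulA : associative bop_mul. Proof. by move=> *; exact: bopP. Qed.
Fact bop_mul1 : left_id bop_one bop_mul. Proof. by move=> *; exact: bopP. Qed.
Fact bop_mulr1 : right_id bop_one bop_mul. Proof. by move=> *; exact: bopP. Qed.
Fact bop_mulDl : left_distributive bop_mul +%R.
Proof. by move=> *; exact: bopP. Qed.
Fact bop_mulDr : right_distributive bop_mul +%R.
Proof. by move=> X Y Z; apply: bopP => f; rewrite /= linearD. Qed.

HB.instance Definition _ := GRing.Zmodule_isPzRing.Build (bop E)
  bop_mulA bop_mul1 bop_mulr1 bop_mulDl bop_mulDr.

Lemma bop1E f : (1 : bop E) f = f. Proof. by []. Qed.
Lemma bopME (X Y : bop E) f : (X * Y) f = X (Y f). Proof. by []. Qed.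

Definition op_norm (X : bop E) : R :=
  sup [set complex.Re `|X f| | f in [set f : E | `|f| <= 1]].

Lemma normRe (f : E) : (complex.Re `|f|)%:C%C = `|f|.
Proof. by rewrite RRe_real// normr_real. Qed.

Lemma op_norm_has_sup (X : bop E) :
  has_sup [set complex.Re `|X f| | f in [set f : E | `|f| <= 1]].
Proof.
split; first by exists (complex.Re `|X 0|), 0 => //=; rewrite normr0.
have /linear_bounded_continuous/bounded_funP/(_ 1)[M HM] :=
  @bop_continuous X.
exists (complex.Re M) => _ [f /= f1 <-].
by have := HM f f1; rewrite lecE => /andP[].
Qed.

Lemma op_norm_ub (X : bop E) f : `|f| <= 1 -> `|X f| <= (op_norm X)%:C%C.
Proof.
move=> f1; rewrite -normRe lecR; apply: ub_le_sup.
  by have [] := op_norm_has_sup X.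
by exists f.
Qed.

Lemma op_norm_le (X : bop E) (c : R) :
  (forall f, `|f| <= 1 -> `|X f| <= c%:C%C) -> op_norm X <= c.
Proof.
move=> Xc; apply: ge_sup; first by have [] := op_norm_has_sup X.
by move=> _ [f /= f1 <-]; rewrite -lecR normRe; exact: Xc.
Qed.

Lemma op_norm_ge0 (X : bop E) : 0 <= op_norm X.
Proof.
rewrite -lecR; apply: le_trans (op_norm_ub (f := 0) X _) => //.
by rewrite normr0.
Qed.

Lemma op_normP (X : bop E) f : `|X f| <= (op_norm X)%:C%C * `|f|.
Proof.
have [->|f0] := eqVneq f 0; first by rewrite linear0 !normr0 mulr0.
have nf0 : 0 < `|f| by rewrite normr_gt0.
rewrite -ler_pdivrMr// mulrC.
have -> : `|f|^-1 * `|X f| = `|X (`|f|^-1 *: f)|.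
  by rewrite linearZ normrZ ger0_norm// invr_ge0 ltW.
apply: op_norm_ub.
rewrite normrZ ger0_norm; last by rewrite invr_ge0 ltW.
by rewrite mulVf// gt_eqF.
Qed.

Fact op_norm_triangle (X Y : bop E) :
  (op_norm (X + Y))%:C%C <= (op_norm X)%:C%C + (op_norm Y)%:C%C.
Proof.
rewrite -rmorphD lecR; apply: op_norm_le => f f1.
by rewrite rmorphD bopDE (le_trans (ler_normD _ _))// lerD ?op_norm_ub.
Qed.

Fact op_normZ (a : R[i]) (X : bop E) :
  (op_norm (a *: X))%:C%C = `|a| * (op_norm X)%:C%C.
Proof.
have nE (b : R[i]) : (complex.Re `|b|)%:C%C = `|b|.
  by rewrite RRe_real// normr_real.
have cM (x y : R) : (x * y)%:C%C = x%:C%C * y%:C%C by exact: rmorphM.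
have le b Y : (op_norm (b *: Y))%:C%C <= `|b| * (op_norm Y)%:C%C.
  rewrite -nE -cM lecR; apply: op_norm_le => f f1.
  by rewrite cM nE bopZE normrZ ler_wpM2l// op_norm_ub.
apply/eqP; rewrite eq_le le andTb.
have [->|a0] := eqVneq a 0; first by rewrite normr0 mul0r lecR op_norm_ge0.
rewrite -ler_pdivlMl ?normr_gt0// -normfV.
by rewrite -[X in op_norm X](scalerK a0); exact: le.
Qed.

Fact op_norm0_eq0 (X : bop E) : (op_norm X)%:C%C = 0 -> X = 0.
Proof.
move=> X0; apply: bopP => f; apply/eqP; rewrite bop0E -normr_le0.
by rewrite (le_trans (op_normP X f))// X0 mul0r.
Qed.

(* [bop E] with the operator norm and the topology it induces. *)
HB.instance Definition _ := @Lmodule_isNormed.Build R[i] (bop E)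
  (fun X => (op_norm X)%:C%C) op_norm_triangle op_normZ op_norm0_eq0.

Lemma bop_normE (X : bop E) : `|X| = (op_norm X)%:C%C.
Proof. by []. Qed.

Definition spectrum (T : bop E) : set R[i] :=
  [set l : R[i] | ~ exists S : bop E,
     S * (l *: (1 : bop E) - T) = 1 /\ (l *: (1 : bop E) - T) * S = 1].

Definition quasinilpotent (T : bop E) : Prop := spectrum T = [set 0].

(* The case [n = 0] only says that [X] is bounded, so it is harmless. *)
Definition deddens (T : bop E) : set (bop E) :=
  [set X | exists2 M : R[i], 0 < M &
    forall (n : nat) (f : E), `|(T ^+ n * X) f| <= M * `|(T ^+ n) f|].

Definition localizing (A : set (bop E)) : Prop :=
  exists (c : E) (r : R[i]), [/\ 0 < r, ~ closed_ball_ Num.norm c r 0 &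
    forall f : nat -> E, (forall n, closed_ball_ Num.norm c r (f n)) ->
      exists (s : nat -> nat) (X : nat -> bop E),
        [/\ {homo s : m n / (m < n)%N},
            forall j, A (X j) /\ `|X j| <= 1 &
            exists2 g : E, g != 0 & X j (f (s j)) @[j --> \oo] --> g]].

Definition hyperinvariant (T : bop E) (F : set E) : Prop :=
  forall S : bop E, S * T = T * S -> S @` F `<=` F.

End BoundedOperatorsSpace.

(* Main.v *)
Require Import Defs.
From HB Require Import structures.
From mathcomp Require Import all_boot all_order all_algebra.
From mathcomp Require Import complex.
From mathcomp Require Import all_classical all_reals all_analysis.
From mathcomp Require Import lra.
Import Order.TTheory GRing.Theory Num.Theory.
Import numFieldNormedType.Exports.
Local Open Scope classical_set_scope.
Local Open Scope ring_scope.

(* Suppose that T has no nontrivial closed hyperinvariant subspace: then T is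
   injective and, for g <> 0, the vectors S g with S commuting with T are dense.
   As the Deddens algebra D is closed, Baire's theorem gives a single M with
   |T^k X f| <= M |T^k f| for all k, f and all X in D with |X| <= 1.
   Let B be the localizing ball.  There is C such that for all f in B some X in D
   with |X| <= 1 and some S commuting with T with |S| <= C satisfy S T X f in B.
   Otherwise take f_n in B violating this with C = n: then X_j f_(n_j) --> g <> 0
   for some X_j in D, so T g <> 0, some S commuting with T sends T g to the
   interior of B, and S T X_j f_(n_j) is in B for large j, a contradiction.
   Iterating f |-> S T X f from the centre g_0 of B produces g_n in B with
   |g_n| <= (C M)^n |T^n| |g_0|.  Quasinilpotence makes these bounds tend to 0
   along a subsequence, but 0 is not in B. *)

(** * Real-valued norms, to which the total order of the reals and its linear arithmetic apply *)

Definition rnorm {R : realType} {V : normedZmodType R[i]} (v : V) : R :=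
  complex.Re `|v|.

Section RealNorm.
Context {R : realType}.

Lemma rnormE {V : normedZmodType R[i]} (v : V) : (rnorm v)%:C%C = `|v|.
Proof. by rewrite /rnorm RRe_real// normr_real. Qed.

Lemma gt0_RRe {e : R[i]} : 0 < e -> e = (complex.Re e)%:C%C /\ 0 < complex.Re e.
Proof.
move=> e0; have eE : (complex.Re e)%:C%C = e by rewrite RRe_real// gtr0_real.
by split; [rewrite eE|rewrite -ltcR eE].
Qed.

Lemma rnorm_ge0 {V : normedZmodType R[i]} (v : V) : 0 <= rnorm v.
Proof. by rewrite -lecR rnormE raddf0 normr_ge0. Qed.

Lemma rnorm0 {V : normedZmodType R[i]} : rnorm (0 : V) = 0.
Proof. by rewrite /rnorm normr0. Qed.

Lemma rnormN {V : normedZmodType R[i]} (v : V) : rnorm (- v) = rnorm v.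
Proof. by rewrite /rnorm normrN. Qed.

Lemma rnormB {V : normedZmodType R[i]} (v w : V) : rnorm (v - w) = rnorm (w - v).
Proof. by rewrite -rnormN opprB. Qed.

Lemma ler_rnormD {V : normedZmodType R[i]} (v w : V) :
  rnorm (v + w) <= rnorm v + rnorm w.
Proof. by rewrite -lecR rmorphD/= !rnormE ler_normD. Qed.

Lemma ler_rnormDB {V : normedZmodType R[i]} (u v w : V) :
  rnorm (u - w) <= rnorm (u - v) + rnorm (v - w).
Proof. by rewrite (le_trans _ (ler_rnormD _ _))// addrA subrK. Qed.

Lemma rnormZ {V : normedModType R[i]} a (v : V) :
  rnorm (a *: v) = rnorm a * rnorm v.
Proof.
by apply: complexI; rewrite -[RHS]/(real_complex R _) rmorphM/= !rnormE normrZ.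
Qed.

Lemma rnormM (a b : R[i]) : rnorm (a * b) = rnorm a * rnorm b.
Proof.
by apply: complexI; rewrite -[RHS]/(real_complex R _) rmorphM/= !rnormE normrM.
Qed.

Lemma rnormX (a : R[i]) n : rnorm (a ^+ n) = rnorm a ^+ n.
Proof.
elim: n => [|n ih]; first by rewrite !expr0 /rnorm normr1.
by rewrite !exprS rnormM ih.
Qed.

Lemma rnorm_real (a : R) : rnorm a%:C%C = `|a|.
Proof. by rewrite /rnorm normc_def /= expr0n addr0 sqrtr_sqr. Qed.

Lemma rnorm_sqr (z : R[i]) :
  rnorm z ^+ 2 = complex.Re z ^+ 2 + complex.Im z ^+ 2.
Proof.
by apply: complexI; rewrite -[LHS]/(real_complex R _) rmorphXn/= rnormE add_Re2_Im2.
Qed.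

Lemma ler_rnorm_ReIm (z : R[i]) : rnorm z <= `|complex.Re z| + `|complex.Im z|.
Proof.
have n0 (x : R) : 0 <= `|x| by [].
rewrite -(@ler_pXn2r _ 2)// ?nnegrE ?rnorm_ge0 ?addr_ge0// rnorm_sqr.
rewrite -[complex.Re z ^+ 2]real_normK ?num_real//.
rewrite -[complex.Im z ^+ 2]real_normK ?num_real// sqrrD lerD2r lerDl.
by rewrite mulrn_wge0 ?mulr_ge0.
Qed.

Lemma ler_Re_rnorm (z : R[i]) : `|complex.Re z| <= rnorm z.
Proof.
rewrite -(@ler_pXn2r _ 2)// ?nnegrE ?rnorm_ge0// rnorm_sqr.
by rewrite real_normK ?num_real// lerDl sqr_ge0.
Qed.

Lemma ler_Im_rnorm (z : R[i]) : `|complex.Im z| <= rnorm z.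
Proof.
rewrite -(@ler_pXn2r _ 2)// ?nnegrE ?rnorm_ge0// rnorm_sqr.
by rewrite real_normK ?num_real// lerDr sqr_ge0.
Qed.

Lemma rnorm_cvgP {V : normedModType R[i]} {T} {F : set_system T}
    {FF : Filter F} (f : T -> V) (y : V) :
  f @ F --> y <-> forall e : R, 0 < e -> \forall t \near F, rnorm (y - f t) <= e.
Proof.
split=> [/cvgrPdist_le H e e0|H].
  have := H e%:C%C; rewrite ltcR => /(_ e0).
  by apply: filterS => t; rewrite -rnormE lecR.
apply/cvgrPdist_le => e /gt0_RRe[-> e0]; have := H _ e0.
by apply: filterS => t; rewrite -[X in _ -> X <= _]rnormE lecR.
Qed.

Lemma rnorm_closureP {V : normedModType R[i]} (A : set V) (x : V) :
  closure A x <-> forall e : R, 0 < e -> exists2 y, A y & rnorm (x - y) < e.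
Proof.
split=> [Ax e e0|H B /nbhs_ballP[e /= /gt0_RRe[eE e0] eB]].
  have /Ax[y [Ay]] : nbhs x (ball x e%:C%C) by apply: nbhsx_ballx; rewrite ltcR.
  by rewrite -ball_normE /= -rnormE ltcR; exists y.
have [y Ay xy] := H _ e0; exists y; split=> //; apply: eB.
by rewrite -ball_normE /= eE -rnormE ltcR.
Qed.

End RealNorm.

(** * Operator norm estimates near the identity *)

Section OperatorNorm.
Context {R : realType} {E : normedModType R[i]}.
Implicit Types X Y : 'B(E).

Lemma bop_rnormE X : rnorm X = op_norm X. Proof. by []. Qed.

Lemma ler_bop_rnorm X f : rnorm (X f) <= rnorm X * rnorm f.
Proof.
by rewrite -lecR -[leRHS]/(real_complex R _) rmorphM/= !rnormE op_normP.
Qed.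

Lemma bop_rnorm_le X (c : R) :
  0 <= c -> (forall f, rnorm (X f) <= c * rnorm f) -> rnorm X <= c.
Proof.
move=> c0 Xc; rewrite bop_rnormE; apply: op_norm_le => f.
rewrite -!rnormE -[1]/((1 : R)%:C%C) !lecR => f1.
by rewrite (le_trans (Xc f))// ler_piMr.
Qed.

Lemma ler_bop_rnormM X Y : rnorm (X * Y) <= rnorm X * rnorm Y.
Proof.
apply: bop_rnorm_le => [|f]; first by rewrite mulr_ge0 ?rnorm_ge0.
rewrite bopME (le_trans (ler_bop_rnorm _ _))// -mulrA ler_wpM2l ?rnorm_ge0//.
exact: ler_bop_rnorm.
Qed.

Lemma ler_bop_rnorm1 : rnorm (1 : 'B(E)) <= 1.
Proof. by apply: bop_rnorm_le => // f; rewrite mul1r. Qed.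

Lemma bop_scalerAl (a : R[i]) X Y : a *: (X * Y) = (a *: X) * Y.
Proof. exact: bopP. Qed.

Lemma bop_scalerAr (a : R[i]) X Y : a *: (X * Y) = X * (a *: Y).
Proof. by apply: bopP => f; rewrite bopZE !bopME bopZE linearZ. Qed.

Lemma bop_exprZ (a : R[i]) X n : (a *: X) ^+ n = a ^+ n *: X ^+ n.
Proof.
elim: n => [|n ih]; first by rewrite !expr0 scale1r.
by rewrite !exprS ih -bop_scalerAl -bop_scalerAr scalerA.
Qed.

(** Here [X - 1 = X * B], so [|X - 1| <= |X| / 4 <= (|X - 1| + 1) / 4]. *)
Lemma rnorm_contract_inv {B X : 'B(E)} :
  X * (1 - B) = 1 -> rnorm B <= 4^-1 -> rnorm (X - 1) <= 3^-1.
Proof.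
rewrite mulrBr mulr1 => /eqP; rewrite subr_eq addrC -subr_eq => /eqP XB B4.
have := ler_bop_rnormM X B; rewrite -XB.
have := ler_rnormD (X - 1) 1; rewrite subrK.
have := ler_wpM2l (rnorm_ge0 X) B4.
have := ler_bop_rnorm1; lra.
Qed.

(** Here [B = (Y - 1) * (1 - B)], so [|B| <= (1 + |B|) / 2]. *)
Lemma rnorm_inv_bound {B Y : 'B(E)} :
  Y * (1 - B) = 1 -> rnorm (Y - 1) <= 2^-1 -> rnorm B <= 1.
Proof.
move=> YB Y2.
have BE : B = (Y - 1) * (1 - B) by rewrite mulrBl YB mul1r opprB addrC subrK.
have := ler_bop_rnormM (Y - 1) (1 - B); rewrite -BE.
have := ler_rnormD (1 : 'B(E)) (- B); rewrite rnormN.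
have := ler_wpM2r (rnorm_ge0 (1 - B)) Y2.
have := ler_bop_rnorm1; lra.
Qed.

End OperatorNorm.

(** * Completeness of the algebra of bounded operators *)

Section Completeness.
Context {R : realType} {E : completeNormedModType R[i]}.

(** The limit is taken pointwise in [E]; letting [m] grow in the Cauchy estimate keeps the rate [r]
    for the limit. *)
Lemma bop_cauchy_limit (Z : nat -> 'B(E)) (r : nat -> R) :
  (forall k m, (k <= m)%N -> rnorm (Z m - Z k) <= r k) ->
  r @ \oo --> (0 : R) -> exists L : 'B(E), forall k, rnorm (L - Z k) <= r k.
Proof.
move=> Zr r0.
have Zrf k m f : (k <= m)%N -> rnorm (Z m f - Z k f) <= r k * rnorm f.
  move=> km; apply: le_trans (ler_bop_rnorm (Z m - Z k) f) _.
  by rewrite ler_wpM2r ?rnorm_ge0 ?Zr.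
pose g f := limn (fun n => Z n f).
have Zg f : Z n f @[n --> \oo] --> g f.
  suff : cvgn (fun n => Z n f) by [].
  apply/cauchy_cvgP/cauchy_exP => z /gt0_RRe[]; set e := complex.Re z => -> e0.
  have rf0 : r n * rnorm f @[n --> \oo] --> (0 : R).
    by rewrite -[0 in X in _ --> X](mul0r (rnorm f)); apply: cvgMl.
  have [k _ /(_ k (leqnn k))/=] := (cvgrPdist_lt _ _).1 rf0 e e0.
  rewrite sub0r normrN => rk; exists (Z k f); exists k => // m /= km.
  rewrite -ball_normE /= -rnormE ltcR rnormB.
  exact: le_lt_trans (Zrf _ _ f km) (le_lt_trans (ler_norm _) rk).
have gr k f : rnorm (g f - Z k f) <= r k * rnorm f.
  apply/ler_addgt0Pr => e e0; have [m _ /= Hm] := (rnorm_cvgP _ _).1 (Zg f) e e0.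
  apply: le_trans (ler_rnormDB _ (Z (maxn k m) f) _) _.
  by rewrite addrC lerD//; [apply/Zrf/leq_maxl|apply/Hm/leq_maxr].
have g_linear : linear g.
  move=> a f h; apply: cvg_lim => //.
  under eq_fun do rewrite linearP.
  by apply: cvgD; [apply: cvgZr; exact: Zg|exact: Zg].
have gB f h : g f - g h = g (f - h).
  by rewrite addrC -scaleN1r -g_linear scaleN1r addrC.
(* The first two summands already bound [g]; the summand 1 makes [K] positive, for the radius
   [e / K]. *)
pose K := r 0%N + rnorm (Z 0%N) + 1.
have K0 : 0 < K.
  rewrite ltr_wpDl// addr_ge0 ?rnorm_ge0//.
  by rewrite (le_trans _ (Zr _ _ (leqnn _)))// rnorm_ge0.
have gK f : rnorm (g f) <= K * rnorm f.
  rewrite -[g f](subrK (Z 0%N f)) (le_trans (ler_rnormD _ _))// !mulrDl mul1r.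
  by rewrite -[leLHS]addr0 !lerD ?gr ?rnorm_ge0 ?ler_bop_rnorm.
have g_cont : continuous g.
  move=> f; apply/rnorm_cvgP => e e0; apply/nbhs_ballP.
  exists (e / K)%:C%C; first by rewrite /= ltcR divr_gt0.
  move=> h; rewrite -ball_normE /= -rnormE ltcR gB => fh.
  by rewrite (le_trans (gK _))// mulrC -ler_pdivlMr// ltW.
have gP : g \in bounded_op E by apply/bounded_opP.
exists (BOp gP) => k; apply: bop_rnorm_le => [|f]; last exact: gr.
by rewrite (le_trans _ (Zr _ _ (leqnn _)))// rnorm_ge0.
Qed.

End Completeness.

(** * Operators with a prescribed Deddens constant *)

Section DeddensBound.
Context {R : realType} {E : normedModType R[i]}.
Variable T : 'B(E).
Implicit Types X Y Z : 'B(E).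

Definition deddens_bound (M : R) X :=
  forall n f, rnorm ((T ^+ n * X) f) <= M * rnorm ((T ^+ n) f).

Lemma deddensP X : deddens T X <-> exists2 M, 0 < M & deddens_bound M X.
Proof.
split=> [[M /gt0_RRe[-> M0] H]|[M M0 H]].
  eexists; first exact: M0.
  by move=> n f; have := H n f; rewrite -!rnormE -rmorphM lecR.
exists M%:C%C; first by rewrite ltcR.
by move=> n f; rewrite -!rnormE -rmorphM lecR.
Qed.

Lemma deddens_bound_le M M' X :
  M <= M' -> deddens_bound M X -> deddens_bound M' X.
Proof.
by move=> MM' H n f; rewrite (le_trans (H n f))// ler_wpM2r ?rnorm_ge0.
Qed.

Lemma deddens_boundD M M' X Y : deddens_bound M X -> deddens_bound M' Y ->
  deddens_bound (M + M') (X + Y).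
Proof.
move=> HX HY n f; rewrite mulrDr bopDE (le_trans (ler_rnormD _ _))// mulrDl.
by rewrite lerD.
Qed.

Lemma deddens_boundZ a M X :
  deddens_bound M X -> deddens_bound (rnorm a * M) (a *: X).
Proof.
move=> HX n f; rewrite -bop_scalerAr bopZE rnormZ -mulrA.
by rewrite ler_wpM2l ?rnorm_ge0.
Qed.

(** One pair [n], [f] violates the bound strictly, and [(T ^+ n * Y) f] depends continuously on
    [Y]. *)
Lemma deddens_bound_open M X : ~ deddens_bound M X ->
  exists2 r : R, 0 < r & forall Y, rnorm (X - Y) <= r -> ~ deddens_bound M Y.
Proof.
move=> /existsNP[n] /existsNP[f] /negP; rewrite -ltNge => gap.
have Tf0 : 0 <= rnorm (T ^+ n) * rnorm f by rewrite mulr_ge0 ?rnorm_ge0.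
(* Within the gap divided by [2 * c], the left side moves by at most half the gap; the summand 1
   keeps [c] positive. *)
set c := rnorm (T ^+ n) * rnorm f + 1; have c0 : 0 < c by rewrite ltr_wpDl.
exists ((rnorm ((T ^+ n * X) f) - M * rnorm ((T ^+ n) f)) / (2 * c)).
  by rewrite divr_gt0 ?subr_gt0 ?mulr_gt0.
move=> Y; rewrite ler_pdivlMr ?mulr_gt0// => XY /(_ n f) HY.
have : rnorm ((T ^+ n * X) f) <=
    rnorm ((T ^+ n * (X - Y)) f) + rnorm ((T ^+ n * Y) f).
  by rewrite (le_trans _ (ler_rnormD _ _))// mulrBr bopDE bopNE subrK.
have : rnorm ((T ^+ n * (X - Y)) f) <= rnorm (X - Y) * c.
  rewrite (le_trans (ler_bop_rnorm _ _))//.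
  rewrite (le_trans (ler_wpM2r (rnorm_ge0 _) (ler_bop_rnormM _ _)))//.
  by rewrite mulrAC mulrC ler_wpM2l ?rnorm_ge0// ler_wpDr.
by move: gap XY; lra.
Qed.

End DeddensBound.

(** * A uniform Deddens constant on the unit ball *)

Section UniformDeddensBound.
Context {R : realType} {E : completeNormedModType R[i]}.
Variable T : 'B(E).

(* The Baire category argument: [deddens T] is the union of the closed sets
   [deddens_bound T k], so one of them has interior in [deddens T]. *)
Lemma deddens_uniform_bound : closed (deddens T) ->
  exists2 M : R, 0 < M &
    forall X, deddens T X -> rnorm X <= 1 -> deddens_bound T M X.
Proof.
move=> DT_closed; apply: contrapT => /forall2NP no_bound.
have large (M : R) : 0 < M ->
    exists X, [/\ deddens T X, rnorm X <= 1 & ~ deddens_bound T M X].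
  move=> M0; have [//|/existsNP[X]] := no_bound M.
  by move=> /not_implyP[DX /not_implyP[X1 nX]]; exists X.
(* A pair is a centre and a radius: the ball of [q] lies in that of [p] and excludes the constant
   [k + 1]. The premises on [p] stand inside the existential so that [choice] applies to every
   [p]. *)
have step (p : nat * ('B(E) * R)) : exists q : 'B(E) * R,
    deddens T p.2.1 -> 0 < p.2.2 ->
    [/\ deddens T q.1, rnorm (q.1 - p.2.1) <= p.2.2 / 2,
        0 < q.2, q.2 <= p.2.2 / 2 &
        forall Y, rnorm (q.1 - Y) <= q.2 -> ~ deddens_bound T p.1.+1%:R Y].
  case: p => k [Z r] /=.
  have [[DZ r0]|] := pselect (deddens T Z /\ 0 < r); last first.
    by move=> N; exists (Z, r) => DZ r0; case: N.
  suff [W [DW ZW nW]] : exists W, [/\ deddens T W, rnorm (W - Z) <= r / 2 &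
      ~ deddens_bound T k.+1%:R W].
    have [s s0 sP] := deddens_bound_open T _ _ nW.
    exists (W, Num.min s (r / 2)) => _ _ /=; split=> //.
    - by rewrite lt_min s0 divr_gt0.
    - by rewrite ge_min lexx orbT.
    - by move=> Y WY; apply: sP; rewrite (le_trans WY)// ge_min lexx.
  have [bZ|] := pselect (deddens_bound T k.+1%:R Z); last first.
    by move=> nZ; exists Z; split=> //; rewrite subrr rnorm0 ltW// divr_gt0.
  (* If both [Z] and [Z + (r / 2) X] had constant [k + 1], their difference scaled by [2 / r] would
     give [X] exactly this constant. *)
  have [|X [DX X1 nX]] := large (2 / r * (k.+1%:R + k.+1%:R)).
    by rewrite mulr_gt0 ?divr_gt0 ?addr_gt0.
  have rC : rnorm (r / 2)%:C%C = r / 2 by rewrite rnorm_real ger0_norm// ltW ?divr_gt0.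
  exists (Z + (r / 2)%:C%C *: X); split.
  - move: DZ DX => /deddensP[M M0 DZ] /deddensP[M' M0' DX]; apply/deddensP.
    exists (M + r / 2 * M'); first by rewrite addr_gt0 ?mulr_gt0 ?divr_gt0.
    apply: deddens_boundD => //.
    by have := deddens_boundZ T (r / 2)%:C%C _ _ DX; rewrite rC.
  - by rewrite addrAC subrr add0r rnormZ rC ler_piMr// ltW ?divr_gt0.
  - move=> bW; apply: nX.
    have rC' : rnorm (2 / r)%:C%C = 2 / r.
      by rewrite rnorm_real ger0_norm// ltW ?divr_gt0.
    have bZ' := deddens_boundZ T (-1) _ _ bZ.
    rewrite rnormN {1}/rnorm normr1 mul1r in bZ'.
    have := deddens_boundZ T (2 / r)%:C%C _ _ (deddens_boundD T _ _ _ _ bW bZ').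
    rewrite rC' scaleN1r addrAC subrr add0r scalerA -rmorphM /= mulrA.
    by rewrite divfK ?gt_eqF// divff ?pnatr_eq0// scale1r.
have [next nextP] := choice step.
have [q [q0E qSE]] : exists q : nat -> 'B(E) * R,
    q 0%N = (0, 1) /\ forall n, q n.+1 = next (n, q n).
  by exists (fix q n := if n is m.+1 then next (m, q m) else (0, 1)).
have qP n : deddens T (q n).1 /\ 0 < (q n).2.
  elim: n => [|n [Dq q0]]; last first.
    by rewrite qSE; have [] := nextP (n, q n) Dq q0.
  rewrite q0E; split=> //; apply/deddensP; exists 1 => // n f.
  by rewrite mulr0 bop0E rnorm0 mul1r rnorm_ge0.
have qS n : [/\ rnorm ((q n.+1).1 - (q n).1) <= (q n).2 / 2,
    (q n.+1).2 <= (q n).2 / 2 &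
    forall Y, rnorm ((q n.+1).1 - Y) <= (q n.+1).2 -> ~ deddens_bound T n.+1%:R Y].
  by rewrite qSE; have [] := nextP (n, q n) (qP n).1 (qP n).2.
have q_geom n : (q n).2 <= (2^-1) ^+ n.
  elim: n => [|n ih]; first by rewrite q0E expr0.
  by have [_ + _] := qS n; rewrite exprS; move: ih; lra.
(* Telescoping: each step moves the centre by at most half the radius, hence by at most the drop in
   radius. *)
have q_dist k n : rnorm ((q (k + n)%N).1 - (q k).1) <= (q k).2 - (q (k + n)%N).2.
  elim: n => [|n ih]; first by rewrite addn0 !subrr rnorm0.
  rewrite addnS; have [+ + _] := qS (k + n)%N.
  move: (ler_rnormDB (q (k + n).+1).1 (q (k + n)%N).1 (q k).1) ih.
  move: (rnorm _) (rnorm _) (rnorm _) (q _).2 (q _).2 (q _).2 => a b c d e f; lra.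
have [||L LP] := bop_cauchy_limit (fun n => (q n).1) (fun n => (q n).2).
- move=> k m /subnKC <-; rewrite (le_trans (q_dist _ _))// gerBl.
  by rewrite ltW// (qP _).2.
- apply: (@squeeze_cvgr _ _ _ _ (fun=> 0) (fun n => (2^-1) ^+ n)).
  + by apply: nearW => n; rewrite q_geom ltW// (qP n).2.
  + exact: cvg_cst.
  + by apply: cvg_expr; rewrite ger0_norm// invf_lt1// ltr1n.
have qL : (q n).1 @[n --> \oo] --> L.
  apply/rnorm_cvgP => e e0.
  have g0 : (2^-1) ^+ n @[n --> \oo] --> (0 : R).
    by apply: cvg_expr; rewrite ger0_norm// invf_lt1// ltr1n.
  have [m _ Hm] := (cvgrPdist_lt _ _).1 g0 e e0; exists m => // n /Hm /=.
  rewrite sub0r normrN ger0_norm ?exprn_ge0// => ne.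
  by rewrite (le_trans (LP n))// (le_trans (q_geom n))// ltW.
have /deddensP[M M0 LM] : deddens T L.
  by apply: (closed_cvg _ DT_closed _ _ qL); apply: nearW => n; exact: (qP n).1.
(* [L] lies in every ball of the sequence, and the ball of index [truncn M + 1] excludes the
   constant [truncn M + 1 > M]. *)
have [_ _ /(_ L)] := qS (Num.truncn M).
rewrite rnormB => /(_ (LP (Num.truncn M).+1)); apply.
by apply: deddens_bound_le LM; rewrite ltW// truncnS_gt.
Qed.

End UniformDeddensBound.

(** * Resolvents of a quasinilpotent operator and decay of its powers *)

Section Quasinilpotent.
Context {R : realType} {E : normedModType R[i]}.
Variable T : 'B(E).

(** [z] is the reciprocal of the spectral parameter, so that for quasinilpotent [T] the family is
    defined on the whole plane. *)
Definition is_resolvent (H : R[i] -> 'B(E)) : Prop :=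
  forall z, H z * (1 - z *: T) = 1 /\ (1 - z *: T) * H z = 1.

Lemma quasinilpotent_resolvent :
  quasinilpotent T -> exists H, is_resolvent H.
Proof.
move=> qT; suff inv z : exists S : 'B(E),
    S * (1 - z *: T) = 1 /\ (1 - z *: T) * S = 1.
  by have [H HP] := choice inv; exists H.
have [->|z0] := eqVneq z 0.
  by exists 1; rewrite scale0r subr0 mul1r.
have : ~ spectrum T z^-1.
  by rewrite qT /= => /eqP; rewrite invr_eq0 (negPf z0).
move=> /contrapT[S [SL SR]]; exists (z^-1 *: S).
have -> : 1 - z *: T = z *: (z^-1 *: (1 : 'B(E)) - T).
  by rewrite scalerBr scalerA divff// scale1r.
by rewrite -!bop_scalerAl -!bop_scalerAr !scalerA mulVf// divff// !scale1r.
Qed.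

Section Resolvent.
Variable H : R[i] -> 'B(E).
Hypothesis H_resolvent : is_resolvent H.

Lemma resolvent_identity z w : H z - H w = (z - w) *: (H z * T * H w).
Proof.
have [Hz _] := H_resolvent z; have [_ Hw] := H_resolvent w.
have zw : (1 - w *: T) - (1 - z *: T) = (z - w) *: T.
  by rewrite opprB addrC addrA subrK scalerBl.
rewrite bop_scalerAl bop_scalerAr -zw mulrBr mulrBl Hz mul1r.
by rewrite -mulrA Hw mulr1.
Qed.

Lemma resolvent_lipschitz z w (S : R) : rnorm (H z) <= S -> rnorm (H w) <= S ->
  rnorm (H z - H w) <= rnorm (z - w) * (S * rnorm T * S).
Proof.
move=> zS wS; rewrite resolvent_identity rnormZ ler_wpM2l ?rnorm_ge0//.
rewrite (le_trans (ler_bop_rnormM _ _))// ler_pM ?rnorm_ge0//.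
by rewrite (le_trans (ler_bop_rnormM _ _))// ler_wpM2r ?rnorm_ge0.
Qed.

(** By the resolvent identity [|H w - H z| <= |w - z| |H w| |T| |H z|], which is at most [|H w| / 2]
    near [z] and is then absorbed into [|H w|]. *)
Lemma resolvent_locally_bounded z : exists2 d : R, 0 < d &
  forall w, rnorm (w - z) <= d -> rnorm (H w) <= 2 * rnorm (H z).
Proof.
have c0 : 0 < 2 * (rnorm T * rnorm (H z) + 1).
  by rewrite mulr_gt0// ltr_wpDl// mulr_ge0 ?rnorm_ge0.
exists (2 * (rnorm T * rnorm (H z) + 1))^-1; first by rewrite invr_gt0.
move=> w wz; have := ler_rnormD (H w - H z) (H z); rewrite subrK.
have : rnorm (H w - H z) <= rnorm (H w) * 2^-1; last by have := rnorm_ge0 (H w); lra.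
rewrite resolvent_identity rnormZ -mulrA.
have le1 : rnorm (H w * (T * H z)) <= rnorm (H w) * (rnorm T * rnorm (H z)).
  rewrite (le_trans (ler_bop_rnormM _ _))// ler_wpM2l ?rnorm_ge0//.
  exact: ler_bop_rnormM.
rewrite (le_trans (ler_wpM2l (rnorm_ge0 _) le1))// mulrCA ler_wpM2l ?rnorm_ge0//.
rewrite (@le_trans _ _ (rnorm (w - z) * (rnorm T * rnorm (H z) + 1)))//.
  by rewrite ler_wpM2l ?rnorm_ge0// lerDl.
by rewrite -ler_pdivlMr -?invfM// -(pmulr_rgt0 _ (_ : 0 < 2 :> R)).
Qed.

(** Compactness of the square [[-K, K]^2], which contains the disc, makes the local bounds
    uniform. *)
Lemma resolvent_bounded (K : R) : exists2 S : R, 0 < S &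
  forall z, rnorm z <= K -> rnorm (H z) <= S.
Proof.
have /compact_near_coveringP/(_ R +oo
    (fun S (p : R * R) => rnorm (H (complex.Complex p.1 p.2)) <= S)) :=
  compact_setX (@segment_compact R (- K) K) (@segment_compact R (- K) K).
case=> [[x y] _|S0 [_ HS]].
  set z := complex.Complex x y.
  have [d d0 Hd] := resolvent_locally_bounded z.
  (* Moving each coordinate by less than [d / 2] moves the point by at most [d]. *)
  exists (ball (x, y) (d / 2), [set S | 2 * rnorm (H z) <= S]).
    split; first by apply: nbhsx_ballx; rewrite divr_gt0.
    exact/nbhs_pinfty_ge/num_real.
  move=> [[x' y'] S] [/= [xx' yy']] /(le_trans _); apply; apply: Hd.
  move: xx' yy'; rewrite -!ball_normE /= => xx' yy'.
  rewrite (le_trans (ler_rnorm_ReIm _))//= [leRHS]splitr.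
  by rewrite distrC [X in _ + X]distrC lerD// ltW.
exists (Num.max S0 0 + 1); first by rewrite ltr_wpDl// le_max lexx orbT.
move=> z zK.
have S0S : S0 < Num.max S0 0 + 1 by rewrite ltr_pwDr// le_max lexx.
have : rnorm (H (complex.Complex (complex.Re z) (complex.Im z))) <= Num.max S0 0 + 1.
  apply: (HS _ S0S (complex.Re z, complex.Im z)).
  by split; rewrite /= in_itv /= -ler_norml (le_trans _ zK)//
    ?ler_Re_rnorm ?ler_Im_rnorm.
by case: (z).
Qed.

Lemma resolvent_uniformly_continuous (K e : R) : 0 < e ->
  exists2 d : R, 0 < d & forall z w, rnorm z <= K -> rnorm w <= K ->
    rnorm (z - w) <= d -> rnorm (H z - H w) <= e.
Proof.
move=> e0; have [S S0 HS] := resolvent_bounded K.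
have c0 : 0 < S * rnorm T * S + 1.
  by rewrite ltr_wpDl// !mulr_ge0 ?rnorm_ge0// ltW.
exists (e / (S * rnorm T * S + 1)); first by rewrite divr_gt0.
move=> z w zK wK; rewrite ler_pdivlMr// => zw.
rewrite (le_trans (resolvent_lipschitz _ _ _ (HS _ zK) (HS _ wK)))//.
by rewrite (le_trans _ zw)// ler_wpM2l ?rnorm_ge0// lerDl.
Qed.

(** The mean of [H] over the products of [z] with the [2 ^ m]-th roots of unity: going from [m] to
    [m + 1] adds the products of these roots with a [2 ^ m]-th root of -1. *)
Fixpoint resolvent_avg m z : 'B(E) :=
  if m is m'.+1 then
    2^-1 *: (resolvent_avg m' z + resolvent_avg m' ((2 ^ m').-root (-1) * z))
  else H z.

(** With [B = (z *: T) ^+ (2 ^ m)], the two summands of the next average are left inverses of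
    [1 - B] and [1 + B], and their mean is one of [1 - B ^+ 2]. *)
Lemma resolvent_avgP m z : resolvent_avg m z * (1 - (z *: T) ^+ (2 ^ m)) = 1.
Proof.
elim: m z => [|m ih] z /=; first by rewrite expn0 expr1; exact: (H_resolvent z).1.
set B := (z *: T) ^+ (2 ^ m).
have HU : resolvent_avg m z * (1 - B) = 1 by exact: ih.
have HV : resolvent_avg m ((2 ^ m).-root (-1) * z) * (1 + B) = 1.
  rewrite -[RHS](ih ((2 ^ m).-root (-1) * z)); congr (_ * (1 + _)).
  by rewrite -scalerA bop_exprZ rootCK ?expn_gt0// scaleN1r opprK.
rewrite -bop_scalerAl expnSr exprM -/B mulrDl.
have B1 : 1 - B ^+ 2 = (1 - B) * (1 + B).
  by rewrite mulrBl mul1r mulrDr mulr1 opprD addrA addrK.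
have B2 : 1 - B ^+ 2 = (1 + B) * (1 - B).
  by rewrite mulrDl mul1r mulrBr mulr1 addrA subrK.
rewrite {1}B1 B2 !mulrA HU HV !mul1r addrACA subrr addr0.
have -> : 1 + 1 = 2 *: (1 : 'B(E)) by rewrite scaler_nat mulr2n.
by rewrite scalerA mulVf ?scale1r// pnatr_eq0.
Qed.

(** Averaging only rotates both points by a common unimodular factor, so a bound valid for all
    rotations survives it. *)
Lemma resolvent_avg_dist (a b : R[i]) (e : R) :
  (forall u, rnorm u = 1 -> rnorm (H (u * a) - H (u * b)) <= e) ->
  forall m u, rnorm u = 1 ->
    rnorm (resolvent_avg m (u * a) - resolvent_avg m (u * b)) <= e.
Proof.
move=> He; elim=> [|m ih] u u1 /=; first exact: He.
rewrite -scalerBr rnormZ !mulrA opprD addrACA.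
have v1 : rnorm ((2 ^ m).-root (-1) * u : R[i]) = 1.
  rewrite rnormM u1 mulr1; apply/eqP.
  rewrite -(@pexpr_eq1 _ _ (2 ^ m)) ?expn_gt0 ?rnorm_ge0// -rnormX.
  by rewrite rootCK ?expn_gt0// rnormN /rnorm normr1.
have -> : rnorm (2^-1 : R[i]) = 2^-1.
  rewrite -[2^-1 in LHS](_ : (2^-1 : R)%:C%C = 2^-1).
    by rewrite rnorm_real ger0_norm// invr_ge0.
  by rewrite fmorphV rmorph_nat.
have := ler_rnormD (resolvent_avg m (u * a) - resolvent_avg m (u * b))
  (resolvent_avg m ((2 ^ m).-root (-1) * u * a)
    - resolvent_avg m ((2 ^ m).-root (-1) * u * b)).
have := ih u u1; have := ih _ v1; lra.
Qed.

End Resolvent.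

Let a (r : R) m := r ^+ (2 ^ m) * rnorm (T ^+ (2 ^ m)).

Let aE (r : R) m : 0 <= r -> rnorm ((r%:C%C *: T) ^+ (2 ^ m)) = a r m.
Proof. by move=> r0; rewrite bop_exprZ rnormZ rnormX rnorm_real ger0_norm. Qed.

Let vanishing (r : R) := forall e : R, 0 < e -> \forall m \near \oo, a r m <= e.

Let vanishing_le r s : 0 <= s -> s <= r -> vanishing r -> vanishing s.
Proof.
move=> s0 sr vr e e0; have [m0 _ H] := vr e e0; exists m0 => // m /H /=.
apply: le_trans; rewrite ler_wpM2r ?rnorm_ge0// lerXn2r// nnegrE//.
exact: le_trans sr.
Qed.

(** [a s m = (s / r) ^+ (2 ^ m) * a r m]: boundedness at one radius forces decay at every smaller
    one. *)
Let vanishing_lt r s : 0 <= s -> s < r ->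
  (\forall m \near \oo, a r m <= 1) -> vanishing s.
Proof.
move=> s0 sr [m0 _ Hm0] e e0; have r0 : 0 < r by exact: le_lt_trans sr.
have q1 : s / r < 1 by rewrite ltr_pdivrMr// mul1r.
have q0 : 0 <= s / r by rewrite divr_ge0// ltW.
have qe : (s / r) ^+ n @[n --> \oo] --> (0 : R) by apply: cvg_expr; rewrite ger0_norm.
have [m1 _ Hm1] := (cvgrPdist_lt _ _).1 qe e e0.
exists (maxn m0 m1) => // m /=; rewrite geq_max => /andP[/Hm0/= am /Hm1/=].
rewrite sub0r normrN ger0_norm ?exprn_ge0// => /ltW; apply: le_trans.
have -> : a s m = (s / r) ^+ (2 ^ m) * a r m.
  by rewrite /a mulrA -exprMn divfK// gt_eqF.
rewrite (@le_trans _ _ ((s / r) ^+ (2 ^ m)))//.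
  by rewrite ler_piMr// exprn_ge0.
by rewrite ler_wiXn2l ?(ltW q1)// ltnW// ltn_expl.
Qed.

(* Averaging [(1 - z T)^-1] over the [2 ^ m]-th roots of unity gives
   [(1 - (z T) ^ (2 ^ m))^-1], whence uniform continuity of the resolvent in a
   disc propagates the decay of [r ^ (2 ^ m) * |T ^ (2 ^ m)|] from [r] to
   [r + d] with [d] independent of [r]: this replaces Cauchy's formula. *)
Lemma quasinilpotent_pow : quasinilpotent T -> forall r e : R, 0 <= r -> 0 < e ->
  \forall m \near \oo, r ^+ (2 ^ m) * rnorm (T ^+ (2 ^ m)) <= e.
Proof.
move=> /quasinilpotent_resolvent[H HP] r e r0.
suff : vanishing r by apply.
(* [6^-1] is the gap between the [3^-1] of [rnorm_contract_inv] and the [2^-1] required by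
   [rnorm_inv_bound]. *)
have [//|d d0 Hd] := resolvent_uniformly_continuous H HP (r + 1) 6^-1.
(* [2 * c] is at most [d], for uniform continuity, and at most 1, to stay in the disc of radius
   [r + 1]. A bound at [s + 2 * c] then gives decay at [s + c]. *)
pose c := Num.min d 1 / 2.
have c0 : 0 < c by rewrite divr_gt0// lt_min d0 ltr01.
have cd : 2 * c <= d by rewrite mulrC divfK// ge_min lexx.
have c1 : 2 * c <= 1 by rewrite mulrC divfK// ge_min lexx orbT.
have step s : 0 <= s -> s <= r -> vanishing s -> vanishing (s + c).
  move=> s0 sr vs; apply: (@vanishing_lt (s + 2 * c)); rewrite ?addr_ge0 ?(ltW c0)//.
    by rewrite ltrD2l; move: c0; lra.
  have [//|m0 _ Hm0] := vs 4^-1; exists m0 => // m /Hm0/=.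
  have t0 : 0 <= s + 2 * c by rewrite addr_ge0// mulr_ge0// ltW.
  rewrite -!aE// => am.
  apply: rnorm_inv_bound (resolvent_avgP H HP m _) _.
  rewrite (le_trans (ler_rnormDB _ (resolvent_avg H m s%:C%C) _))//.
  have -> : 2^-1 = 6^-1 + 3^-1 :> R by lra.
  rewrite lerD ?(rnorm_contract_inv (resolvent_avgP H HP m _) am)//.
  rewrite -[(s + 2 * c)%:C%C]mul1r -[s%:C%C]mul1r.
  apply: resolvent_avg_dist; last by rewrite /rnorm normr1.
  move=> u u1; apply: Hd; rewrite -?mulrBr rnormM u1 mul1r ?rnorm_real.
  - by rewrite ger0_norm//; move: c1 sr; lra.
  - by rewrite ger0_norm//; move: sr; lra.
  - by rewrite -rmorphB rnorm_real/= addrAC subrr add0r ger0_norm// mulr_ge0// ltW.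
(* The climb starts at radius 0, where [a] vanishes, and goes by steps of [c], capped at [r]. *)
have climb k : vanishing (Num.min (k%:R * c) r).
  elim: k => [|k ih].
    rewrite mul0r min_l// => e' e0'; apply: nearW => m.
    by rewrite /a expr0n expn_eq0/= mul0r ltW.
  have m0 : 0 <= Num.min (k%:R * c) r by rewrite le_min r0 andbT mulr_ge0// ltW.
  have := step _ m0 _ ih; rewrite ge_min lexx orbT => /(_ isT).
  apply: vanishing_le; first by rewrite le_min r0 andbT mulr_ge0// ltW.
  by rewrite addr_minl le_min !ge_min -natr1 mulrDl mul1r lexx/= lerDl (ltW c0) orbT.
have := climb (Num.truncn (r / c)).+1; rewrite min_r//.
by rewrite -ler_pdivrMr// ltW// truncnS_gt.
Qed.

End Quasinilpotent.

(** * Hyperinvariant subspaces and returns to the localizing ball *)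

Section Hyperinvariant.
Context {R : realType} {E : normedModType R[i]}.
Variable T : 'B(E).
Implicit Types S X : 'B(E).

Lemma kernel_hyperinvariant : [/\ closed [set f | T f = 0],
  submod_closed (mem [set f | T f = 0]) & hyperinvariant T [set f | T f = 0]].
Proof.
split.
- have /continuous_closedP/(_ [set 0]) := @bop_continuous _ _ T; apply.
  exact/accessible_closed_set1/hausdorff_accessible/norm_hausdorff.
- split; first by rewrite inE /= linear0.
  by move=> a f g; rewrite !inE /= => Tf Tg; rewrite linearP /= Tf Tg scaler0 addr0.
- move=> S ST _ [f /= f0 <-] /=.
  by rewrite -bopME -ST bopME f0 linear0.
Qed.

Definition commutant_orbit (g : E) : set E :=
  [set h | exists2 S, S * T = T * S & h = S g].

(** The commutant is an algebra, so the orbit is a subspace stable under it; boundedness of the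
    operators carries this to the closure. *)
Lemma commutant_orbit_closure_hyperinvariant g :
  submod_closed (mem (closure (commutant_orbit g))) /\
  hyperinvariant T (closure (commutant_orbit g)).
Proof.
have orbit_submod a S S' : S * T = T * S -> S' * T = T * S' ->
    (a *: S + S') * T = T * (a *: S + S').
  by move=> ST ST'; rewrite mulrDl mulrDr -bop_scalerAl -bop_scalerAr ST ST'.
split; first split.
- rewrite inE; apply: subset_closure; exists 0; first by rewrite mul0r mulr0.
  by rewrite bop0E.
- move=> a f f'; rewrite !inE => /rnorm_closureP Hf /rnorm_closureP Hf'.
  apply/rnorm_closureP => e e0.
  have c0 : 0 < 2 * (rnorm a + 1) by rewrite mulr_gt0// ltr_wpDl// rnorm_ge0.
  have [|_ [S ST ->] fS] := Hf (e / (2 * (rnorm a + 1))); first by rewrite divr_gt0.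
  have [|_ [S' ST' ->] fS'] := Hf' (e / 2); first by rewrite divr_gt0.
  exists ((a *: S + S') g); first by exists (a *: S + S'); rewrite ?orbit_submod.
  rewrite bopDE bopZE opprD addrACA -scalerBr.
  rewrite (le_lt_trans (ler_rnormD _ _))// rnormZ [ltRHS]splitr ler_ltD//.
  rewrite (@le_trans _ _ ((rnorm a + 1) * rnorm (f - S g)))//.
    by rewrite ler_wpM2r ?rnorm_ge0// lerDl.
  by move: fS; rewrite ltr_pdivlMr// ler_pdivlMr// => /ltW; apply: le_trans; lra.
- move=> S ST _ [f /rnorm_closureP Hf <-]; apply/rnorm_closureP => e e0.
  have c0 : 0 < rnorm S + 1 by rewrite ltr_wpDl// rnorm_ge0.
  have [|_ [S' ST' ->] fS'] := Hf (e / (rnorm S + 1)); first by rewrite divr_gt0.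
  exists ((S * S') g).
    by exists (S * S') => //; rewrite -mulrA ST' !mulrA ST.
  rewrite bopME -linearB (le_lt_trans (ler_bop_rnorm _ _))//.
  move: fS'; rewrite ltr_pdivlMr// mulrC; apply: le_lt_trans.
  by rewrite ler_wpM2r ?rnorm_ge0// lerDl.
Qed.

Hypothesis T_inj : forall f, T f = 0 -> f = 0.
Hypothesis commutant_transitive :
  forall g, g != 0 -> closure (commutant_orbit g) = setT.

Lemma localizing_return (A : set 'B(E)) (c : E) (r : R) : 0 < r ->
  (forall f : nat -> E, (forall n, rnorm (c - f n) <= r) ->
      exists (s : nat -> nat) (X : nat -> 'B(E)),
        [/\ {homo s : m n / (m < n)%N},
            forall j, A (X j) /\ `|X j| <= 1 &
            exists2 g : E, g != 0 & X j (f (s j)) @[j --> \oo] --> g]) ->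
  exists2 C : R, 0 < C & forall f, rnorm (c - f) <= r -> exists X S,
    [/\ A X, rnorm X <= 1, S * T = T * S, rnorm S <= C &
        rnorm (c - S (T (X f))) <= r].
Proof.
move=> r0 loc; apply: contrapT => /forall2NP H.
(* Failure for [C = n + 1]: no commuting [S] with norm at most [n + 1] brings [f n] back to the
   ball. *)
have /choice[f fP] (n : nat) : exists f, rnorm (c - f) <= r /\
    forall X S, A X -> rnorm X <= 1 -> S * T = T * S -> rnorm S <= n.+1%:R ->
      ~ rnorm (c - S (T (X f))) <= r.
  have [//|/existsNP[f /not_implyP[fc nf]]] := H n.+1%:R.
  by exists f; split=> // X S AX X1 ST Sn cS; apply: nf; exists X, S.
have [s [X [s_incr XP [g g0 Xg]]]] := loc f (fun n => (fP n).1).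
have Tg0 : T g != 0 by apply: contra_neq g0; exact: T_inj.
(* Half of [r] is spent on approximating [c] by [S (T g)], half on replacing [g] by
   [X j (f (s j))]. *)
have /rnorm_closureP/(_ (r / 2))[|_ [S ST ->] cS] : closure (commutant_orbit (T g)) c.
- by rewrite commutant_transitive.
- by rewrite divr_gt0.
have c0 : 0 < rnorm (S * T) + 1 by rewrite ltr_wpDl// rnorm_ge0.
have [|j0 _ Hj0] := (rnorm_cvgP _ _).1 Xg (r / 2 / (rnorm (S * T) + 1)).
  by rewrite !divr_gt0.
(* Large enough for the convergence and, since [j <= s j], for [|S| <= s j + 1]. *)
pose j := maxn j0 (Num.truncn (rnorm S)).
have s_ge k : (k <= s k)%N by elim: k => // k ih; rewrite (leq_ltn_trans ih)// s_incr.
have [AX X1] := XP j; apply: ((fP (s j)).2 _ _ AX _ ST).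
- by rewrite -lecR rnormE.
- rewrite (@le_trans _ _ (Num.truncn (rnorm S)).+1%:R) ?(ltW (truncnS_gt _))//.
  by rewrite ler_nat ltnS (@leq_trans j) ?leq_maxr.
- rewrite (le_trans (ler_rnormDB _ (S (T g)) _))// [leRHS]splitr lerD ?(ltW cS)//.
  rewrite -!bopME -mulrA -linearB (le_trans (ler_bop_rnorm _ _))//.
  have /= := Hj0 j (leq_maxl _ _); rewrite ler_pdivlMr// mulrC; apply: le_trans.
  by rewrite ler_wpM2r ?rnorm_ge0// lerDl.
Qed.

End Hyperinvariant.

(** * Iterated returns against quasinilpotent decay *)

Theorem theorem2 (R : realType) (E : completeNormedModType R[i])
    (T : 'B(E)) (T_neq0 : T != 0) (T_qn : quasinilpotent T)
    (DT_closed : closed (deddens T)) (DT_loc : localizing (deddens T)) :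
  exists F : set E,
    [/\ closed F, submod_closed (mem F), F <> [set 0], F <> setT &
        hyperinvariant T F].
Proof.
apply: contrapT => no_hyper.
have trivial F : closed F -> submod_closed (mem F) -> hyperinvariant T F ->
    F <> [set 0] -> F = setT.
  by move=> cF sF hF F0; apply: contrapT => FT; apply: no_hyper; exists F.
have T_inj f : T f = 0 -> f = 0.
  have [cK sK hK] := kernel_hyperinvariant T.
  suff K0 : [set f | T f = 0] = [set 0].
    by move=> Tf; have : [set f | T f = 0] f := Tf; rewrite K0.
  apply: contrapT => /(trivial _ cK sK hK) KT; move/eqP: T_neq0; apply.
  by apply: bopP => h; have : [set: E] h by []; rewrite -KT.
have dense g : g != 0 -> closure (commutant_orbit T g) = setT.
  move=> g0; have [sF hF] := commutant_orbit_closure_hyperinvariant T g.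
  apply: trivial => //; first exact: closed_closure.
  move=> F0; have : closure (commutant_orbit T g) g.
    by apply: subset_closure; exists 1; rewrite ?mul1r ?mulr1.
  by rewrite F0 /= => /eqP; rewrite (negPf g0).
have [c [z [/gt0_RRe[]]]] := DT_loc.
set r := complex.Re z => -> r0 c_ball loc.
have rc : r < rnorm c.
  rewrite ltNge; apply/negP => cr; apply: c_ball.
  by rewrite /closed_ball_ /= subr0 -rnormE lecR.
have [|C C0 HC] :=
    localizing_return T T_inj dense (deddens T) c _ r0.
  by move=> f fP; apply: loc => n; have := fP n; rewrite -lecR rnormE.
have [M M0 HM] := deddens_uniform_bound T DT_closed.
(* The return map, made total by an arbitrary value 0 outside the ball. *)
have /choice[next nextP] (f : E) : exists f', rnorm (c - f) <= r ->
    rnorm (c - f') <= r /\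
    forall k, rnorm ((T ^+ k) f') <= C * M * rnorm ((T ^+ k.+1) f).
  have [/HC[X [S [DX X1 ST SC cf']]]|] := pselect (rnorm (c - f) <= r); last first.
    by move=> nf; exists 0.
  exists (S (T (X f))) => _; split=> // k.
  (* [S] is moved past [T ^+ k], so that the Deddens bound applies with exponent [k + 1]. *)
  have -> : (T ^+ k) (S (T (X f))) = S ((T ^+ k.+1 * X) f).
    rewrite exprSr -!bopME !mulrA.
    by have -> : T ^+ k * S = S * T ^+ k by exact/esym/commrX.
  rewrite (le_trans (ler_bop_rnorm _ _))// -mulrA.
  by rewrite ler_pM ?rnorm_ge0 ?HM.
pose f n := iter n next c.
have f_ball n : rnorm (c - f n) <= r.
  by elim: n => [|n /nextP[]//]; rewrite /f /= subrr rnorm0 ltW.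
(* Quantifying over [k] lets the induction trade each return for one more power of [T] on the
   previous vector. *)
have f_decay n k : rnorm ((T ^+ k) (f n)) <= (C * M) ^+ n * rnorm ((T ^+ (k + n)) c).
  elim: n k => [|n ih] k; first by rewrite addn0 expr0 mul1r.
  have [_ /(_ k)] := nextP _ (f_ball n); move/le_trans; apply.
  rewrite [_ ^+ n.+1]exprS -[leRHS]mulrA addnS -addSn.
  by rewrite ler_wpM2l ?mulr_ge0 ?(ltW C0) ?(ltW M0).
have c0 : 0 < rnorm c by exact: lt_trans rc.
have CM0 : 0 <= C * M by rewrite mulr_ge0// ltW.
(* Times [|c|], this is half the distance from 0 to the ball. *)
have e0 : 0 < (rnorm c - r) / 2 / rnorm c by rewrite !divr_gt0// subr_gt0.
have [m _ /(_ m (leqnn m))/=] := quasinilpotent_pow T T_qn _ _ CM0 e0.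
rewrite ler_pdivlMr// -mulrA => small.
have := f_decay (2 ^ m)%N 0%N; rewrite expr0 bop1E add0n => fn.
have {}fn : rnorm (f (2 ^ m)%N) <= (rnorm c - r) / 2.
  rewrite (le_trans fn)// (le_trans _ small)//.
  by rewrite ler_wpM2l ?exprn_ge0 ?ler_bop_rnorm.
have := ler_rnormD (c - f (2 ^ m)%N) (f (2 ^ m)%N); rewrite subrK.
have := f_ball (2 ^ m)%N; move: fn rc.
move: (rnorm _) (rnorm _) (rnorm _) => x y t; lra.
Qed.
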